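(* Let $d \geq 1$, let $\mathcal{X} \subset \mathbb{R}^d$, and let $M \in \mathbb{R}^{d \times d}$ be a symmetric positive semi-definite matrix, written as $M = L^T L$ with $L \in \mathbb{R}^{d\times d}$ a lower triangular matrix. Then the Mahalanobis distance $$d_M : \mathcal{X}^2 \to \mathbb{R}, \qquad d_M(x_1,x_2) = \sqrt{(x_1-x_2)^T M (x_1-x_2)},$$ is $k$-lipschitz with respect to the norm $\|\cdot\|_2$, with $k = \sqrt{2}\,\|L\|_2$.
   Context: A function $f : \mathcal{X}^2 \subset \mathbb{R}^d \times \mathbb{R}^d \to \mathbb{R}$ is said to be $k$-lipschitz with respect to the norm $\|\cdot\|_2$ if for all $(x_1,x_2,x_1',x_2') \in \mathcal{X}^4$, $$|f(x_1,x_2) - f(x_1',x_2')| \leq k \left\| \begin{pmatrix} x_1 \\ x_2 \end{pmatrix} - \begin{pmatrix} x_1' \\ x_2' \end{pmatrix} \right\|_2,$$ where $\begin{pmatrix} x_1 \\ x_2 \end{pmatrix} \in \mathbb{R}^{2d}$ denotes the concatenation of $x_1$ and $x_2$. For vectors, $\|\cdot\|_2$ is the Euclidean norm; for matrices, $\|\cdot\|_2$ is the induced operator (spectral) norm. *)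

(* Defs.v *)
From mathcomp Require Import all_boot all_order all_algebra.
From mathcomp Require Import all_classical all_reals.

Set Implicit Arguments.
Unset Strict Implicit.
Unset Printing Implicit Defensive.

Import Order.TTheory GRing.Theory Num.Theory.

Local Open Scope classical_set_scope.
Local Open Scope ring_scope.

(* The library norm on matrices is the max norm, hence the norms below. *)
Definition vnorm2 (R : realType) (n : nat) (x : 'cV[R]_n) : R :=
  Num.sqrt (\sum_(i < n) x i 0 ^+ 2).

Definition mnorm2 (R : realType) (m n : nat) (A : 'M[R]_(m, n)) : R :=
  sup [set vnorm2 (A *m x) | x in [set x : 'cV[R]_n | vnorm2 x <= 1]].

Definition psdmx (R : realType) (n : nat) (M : 'M[R]_n) : Prop :=
  M \is symmetricmx /\ forall x : 'cV[R]_n, 0 <= (x^T *m M *m x) 0 0.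

(* A function on X^2 is represented by a function on all pairs of vectors, of
   which only the values on X^2 matter. *)
Definition lipschitz2 (R : realType) (d : nat) (X : set 'cV[R]_d) (k : R)
    (f : 'cV[R]_d -> 'cV[R]_d -> R) : Prop :=
  forall x1 x2 x1' x2' : 'cV[R]_d, X x1 -> X x2 -> X x1' -> X x2' ->
    `|f x1 x2 - f x1' x2'| <= k * vnorm2 (col_mx x1 x2 - col_mx x1' x2').

Definition mahalanobis (R : realType) (d : nat) (M : 'M[R]_d)
    (x1 x2 : 'cV[R]_d) : R :=
  Num.sqrt (((x1 - x2)^T *m M *m (x1 - x2)) 0 0).

(* Main.v *)
Require Import Defs.
From mathcomp Require Import all_boot all_order all_algebra.
From mathcomp Require Import all_classical all_reals.
From mathcomp Require Import ring lra.

Set Implicit Arguments.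
Unset Strict Implicit.
Unset Printing Implicit Defensive.

Import Order.TTheory GRing.Theory Num.Theory.

Local Open Scope classical_set_scope.
Local Open Scope ring_scope.

(** Since M = L^T L, the Mahalanobis distance is the Euclidean norm of
    L (x1 - x2).  The reverse triangle inequality therefore bounds the
    variation of the distance by the norm of L (a - b), where a = x1 - x1' and
    b = x2 - x2', which is at most the operator norm of L times the norm of
    a - b ([vnorm2_mulmx_le]).  The factor sqrt 2 compares a - b with the stacked
    vector (a, b), by (s - t)^2 <= 2 (s^2 + t^2) on each coordinate
    ([vnorm2_sub_le_col_mx]).

    The operator norm is a supremum, so using it as an upper bound requires the
    image of the unit ball to be bounded; the Cauchy-Schwarz inequality on each
    row of the matrix gives the Frobenius norm as a bound
    ([vnorm2_mulmx_le_frobenius]).  Cauchy-Schwarz also yields the triangle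
    inequality. *)

Lemma sum_sqr_ge0 (R : realType) n (x : 'cV[R]_n) :
  0 <= \sum_(i < n) x i 0 ^+ 2.
Proof. by apply: sumr_ge0 => i _; exact: sqr_ge0. Qed.

Lemma vnorm2_ge0 (R : realType) n (x : 'cV[R]_n) : 0 <= vnorm2 x.
Proof. exact: sqrtr_ge0. Qed.

Lemma sqr_vnorm2 (R : realType) n (x : 'cV[R]_n) :
  vnorm2 x ^+ 2 = \sum_(i < n) x i 0 ^+ 2.
Proof. by rewrite /vnorm2 sqr_sqrtr // sum_sqr_ge0. Qed.

Lemma vnorm2Z (R : realType) n (c : R) (x : 'cV[R]_n) :
  vnorm2 (c *: x) = `|c| * vnorm2 x.
Proof.
rewrite /vnorm2 -sqrtr_sqr -sqrtrM ?sqr_ge0 // mulr_sumr.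
by congr Num.sqrt; apply: eq_bigr => i _; rewrite mxE exprMn.
Qed.

Lemma vnorm2_0 (R : realType) n : vnorm2 (0 : 'cV[R]_n) = 0.
Proof. by rewrite -[0 in LHS](scale0r 0) vnorm2Z normr0 mul0r. Qed.

Lemma vnorm2_eq0 (R : realType) n (x : 'cV[R]_n) : vnorm2 x = 0 -> x = 0.
Proof.
move=> x0; have := sqr_vnorm2 x; rewrite x0 expr0n /= => /esym/eqP.
rewrite psumr_eq0 => [/allP xi0|i _]; last exact: sqr_ge0.
apply/matrixP => i j; rewrite ord1 mxE; apply/eqP.
by have := xi0 i (mem_index_enum i); rewrite sqrf_eq0.
Qed.

(** Nonnegativity of |B x - A y|^2, where A = |x| and B = |y|, reads
    A B <x, y> <= (A B)^2, and A B can be cancelled unless x or y vanishes. *)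
Lemma cauchy_schwarz (R : realType) n (x y : 'cV[R]_n) :
  \sum_(i < n) x i 0 * y i 0 <= vnorm2 x * vnorm2 y.
Proof.
have [x0|x_neq0] := eqVneq (vnorm2 x) 0.
  rewrite x0 mul0r (vnorm2_eq0 x0) big1 // => i _.
  by rewrite mxE mul0r.
have [y0|y_neq0] := eqVneq (vnorm2 y) 0.
  rewrite y0 mulr0 (vnorm2_eq0 y0) big1 // => i _.
  by rewrite mxE mulr0.
have xy_gt0 : 0 < vnorm2 x * vnorm2 y.
  by rewrite mulr_gt0 // lt_neqAle eq_sym vnorm2_ge0 ?x_neq0 ?y_neq0.
rewrite -(ler_pM2l xy_gt0).
have := sum_sqr_ge0 (vnorm2 y *: x - vnorm2 x *: y).
under eq_bigr => i _.
  rewrite (_ : _ ^+ 2 = vnorm2 y ^+ 2 * x i 0 ^+ 2 + vnorm2 x ^+ 2 * y i 0 ^+ 2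
    + (- (2 * (vnorm2 x * vnorm2 y))) * (x i 0 * y i 0)); last first.
    by rewrite !mxE; ring.
  over.
rewrite !big_split /= -!mulr_sumr -!sqr_vnorm2 => h.
nra.
Qed.

Lemma vnorm2D (R : realType) n (x y : 'cV[R]_n) :
  vnorm2 (x + y) <= vnorm2 x + vnorm2 y.
Proof.
rewrite -(ler_pXn2r (n := 2)) ?nnegrE ?addr_ge0 ?vnorm2_ge0 //.
rewrite sqr_vnorm2.
under eq_bigr => i _ do rewrite mxE sqrrD -mulr_natr.
rewrite !big_split /= -mulr_suml -!sqr_vnorm2.
have := cauchy_schwarz x y; nra.
Qed.

Lemma dist_vnorm2_le (R : realType) n (x y : 'cV[R]_n) :
  `|vnorm2 x - vnorm2 y| <= vnorm2 (x - y).
Proof.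
have hx := vnorm2D (x - y) y; rewrite subrK in hx.
have hy := vnorm2D (y - x) x; rewrite subrK in hy.
have yx : vnorm2 (y - x) = vnorm2 (x - y).
  by rewrite -opprB -scaleN1r vnorm2Z normrN1 mul1r.
by rewrite yx in hy; rewrite ler_norml; apply/andP; split; lra.
Qed.

Lemma vnorm2_sub_le_col_mx (R : realType) n (x y : 'cV[R]_n) :
  vnorm2 (x - y) <= Num.sqrt 2 * vnorm2 (col_mx x y).
Proof.
rewrite /vnorm2 -sqrtrM // ler_wsqrtr // big_split_ord /=.
under [X in _ * (X + _)]eq_bigr => i _ do rewrite col_mxEu.
under [X in _ * (_ + X)]eq_bigr => i _ do rewrite col_mxEd.
rewrite -big_split mulr_sumr /=; apply: ler_sum => i _; rewrite !mxE.
have := sqr_ge0 (x i 0 + y i 0); nra.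
Qed.

Lemma vnorm2_mulmx_le_frobenius (R : realType) m n (A : 'M[R]_(m, n))
    (x : 'cV[R]_n) :
  vnorm2 (A *m x) <= Num.sqrt (\sum_(i < m) \sum_(j < n) A i j ^+ 2) * vnorm2 x.
Proof.
have A_ge0 i : 0 <= \sum_(j < n) A i j ^+ 2.
  by apply: sumr_ge0 => j _; exact: sqr_ge0.
rewrite {2}/vnorm2 -sqrtrM ?sumr_ge0 // ler_wsqrtr // mulr_suml.
apply: ler_sum => i _.
have rowE : \sum_(j < n) A i j ^+ 2 = vnorm2 (row i A)^T ^+ 2.
  by rewrite sqr_vnorm2; apply: eq_bigr => j _; rewrite !mxE.
have AxE (y : 'cV[R]_n) :
    (A *m y) i 0 = \sum_(j < n) (row i A)^T j 0 * y j 0.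
  by rewrite mxE; apply: eq_bigr => j _; rewrite !mxE.
rewrite rowE -sqr_vnorm2 -exprMn -ler_sqrt ?sqr_ge0 // !sqrtr_sqr.
rewrite [leRHS]ger0_norm ?mulr_ge0 ?vnorm2_ge0 //.
(* Cauchy-Schwarz bounds the inner product from above; its opposite is the
   inner product with - x. *)
have le_x := cauchy_schwarz (row i A)^T x.
have := cauchy_schwarz (row i A)^T (- x).
rewrite -!AxE mulmxN [X in X <= _]mxE -scaleN1r vnorm2Z normrN1 mul1r => le_Nx.
by rewrite -AxE in le_x; rewrite ler_norml; apply/andP; split; lra.
Qed.

(** The supremum defining the operator norm is a genuine upper bound only once
    the set is known to be bounded. *)
Lemma has_ubound_mulmx_ball (R : realType) m n (A : 'M[R]_(m, n)) :
  has_ubound [set vnorm2 (A *m x) | x in [set x : 'cV[R]_n | vnorm2 x <= 1]].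
Proof.
exists (Num.sqrt (\sum_(i < m) \sum_(j < n) A i j ^+ 2)) => _ [y /= y_le1 <-].
apply: le_trans (vnorm2_mulmx_le_frobenius A y) _.
by rewrite ler_piMr ?sqrtr_ge0.
Qed.

Lemma vnorm2_mulmx_le (R : realType) m n (A : 'M[R]_(m, n)) (x : 'cV[R]_n) :
  vnorm2 (A *m x) <= mnorm2 A * vnorm2 x.
Proof.
have [x0|x_neq0] := eqVneq (vnorm2 x) 0.
  by rewrite x0 (vnorm2_eq0 x0) mulmx0 vnorm2_0 mulr0.
have x_gt0 : 0 < vnorm2 x by rewrite lt_neqAle eq_sym x_neq0 vnorm2_ge0.
rewrite -ler_pdivrMr // mulrC.
rewrite -[X in X * _]ger0_norm ?invr_ge0 ?vnorm2_ge0 //.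
rewrite -vnorm2Z scalemxAr; apply: (ub_le_sup (has_ubound_mulmx_ball A)).
exists ((vnorm2 x)^-1 *: x) => //=.
by rewrite vnorm2Z ger0_norm ?invr_ge0 ?vnorm2_ge0 // mulVf.
Qed.

Lemma mnorm2_ge0 (R : realType) m n (A : 'M[R]_(m, n)) : 0 <= mnorm2 A.
Proof.
apply: (ub_le_sup (has_ubound_mulmx_ball A)).
by exists 0 => /=; rewrite ?mulmx0 vnorm2_0.
Qed.

Lemma mahalanobis_vnorm2 (R : realType) d (L : 'M[R]_d) (x y : 'cV[R]_d) :
  mahalanobis (L^T *m L) x y = vnorm2 (L *m (x - y)).
Proof.
rewrite /mahalanobis /vnorm2 mulmxA -trmx_mul -mulmxA [in LHS]mxE.
by congr Num.sqrt; apply: eq_bigr => i _; rewrite mxE expr2.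
Qed.

(* [is_trig_mx L] means that [L] is lower triangular: L i j = 0 for i < j. *)
Theorem lemma2p1 (R : realType) (d : nat) (hd : (1 <= d)%N)
    (X : set 'cV[R]_d) (M L : 'M[R]_d)
    (hM : psdmx M) (hL : is_trig_mx L) (hML : M = L^T *m L) :
  lipschitz2 X (Num.sqrt 2 * mnorm2 L) (mahalanobis M).
Proof.
move=> x1 x2 x1' x2' _ _ _ _; rewrite hML !mahalanobis_vnorm2.
apply: le_trans (dist_vnorm2_le _ _) _; rewrite -mulmxBr.
apply: le_trans (vnorm2_mulmx_le _ _) _.
rewrite [Num.sqrt 2 * _]mulrC -mulrA ler_wpM2l ?mnorm2_ge0 //.
rewrite opp_col_mx add_col_mx.
rewrite (_ : _ - _ = (x1 - x1') - (x2 - x2')).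
  exact: vnorm2_sub_le_col_mx.
by apply/matrixP => i j; rewrite !mxE; ring.
Qed.
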